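(* Let $r\geq 1$ be an integer and $\gamma>0$. There are positive constants $A_{r,\gamma}$ and $B_{r,\gamma}$, depending only on $r$ and $\gamma$, such that if $(S,\mathcal S)$ is a measurable space, $h\colon S^r\to\mathbb R$ is a symmetric measurable function (with $S^r$ endowed with the product $\sigma$-algebra), $(X_i)_{i\geq 1}$ is an i.i.d. sequence of $S$-valued random variables and $h$ is degenerated of order $i-1$ for some $i\in\{2,\dots,r\}$, then for all $$x\geq x_{r,i,\gamma}:=3^{r\frac{2+i\gamma}{i\gamma}}\,2^{-1/\gamma}\,C_r^{-1}$$ and all $N\geq r$, $$\mathbb P\left\{\max_{r\leq n\leq N}|U_n|>N^{r-i/2}x\right\}\leq A_{r,\gamma}\exp\left(-B_{r,\gamma}\,x^{\frac{2\gamma}{i\gamma+2}}\right)\mathbb E\left[\exp\left(|h(X_1,\dots,X_r)|^\gamma\right)\right].$$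
   Context: For $n\geq r$, $U_n=U_{r,n}(h):=\sum_{1\leq i_1<\dots<i_r\leq n}h(X_{i_1},\dots,X_{i_r})$. The kernel $h$ is symmetric if it is invariant under all permutations of its $r$ arguments. Degeneracy: let $Y:=h(X_1,\dots,X_r)$ be integrable and let $\mathcal F_j$ be the $\sigma$-algebra generated by $X_1,\dots,X_j$. For $i\in\{2,\dots,r\}$, $h$ is degenerated of order $i-1$ if $\mathbb E[Y\mid\mathcal F_{i-1}]=0$ almost surely but $\mathbb E[Y\mid\mathcal F_i]$ is not almost surely equal to zero. The constant $C_r>0$ depends only on $r$; it is a constant for which (together with some positive constants $A_r,B_r$ depending only on $r$) the following inequality holds for every measurable space $(S,\mathcal S)$, every symmetric measurable $h\colon S^r\to\mathbb R$, every i.i.d. sequence $(X_i)_{i\ge1}$ in $S$ with $h$ degenerated of order $i-1$, $i\in\{2,\dots,r\}$, all $N\geq r$ and all $x,y>0$ with $x/y>3^r$: $$\mathbb P\left\{\max_{r\leq n\leq N}|U_n|>N^{r-\frac i2}x\right\}\leq A_r\exp\left(-\frac12\left(\frac xy\right)^{2/i}\right)+B_r\sum_{k=i}^r\int_1^{+\infty}\mathbb P\left\{\left|\mathbb E\left[h(X_1,\dots,X_r)\mid X_1,\dots,X_k\right]\right|>yN^{\frac{k-i}2}u^{1/2}C_r\right\}(1+\ln u)^{\frac{k(k-1)}{2}}\,\mathrm du.$$ *)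

(* Defs.v *)
From HB Require Import structures.
From mathcomp Require Import all_boot all_order all_algebra perm finmap.
From mathcomp Require Import all_classical all_reals all_analysis.

Set Implicit Arguments.
Unset Strict Implicit.
Unset Printing Implicit Defensive.

Import Order.TTheory GRing.Theory Num.Theory.
Import numFieldNormedType.Exports.

Local Open Scope classical_set_scope.
Local Open Scope ring_scope.

(* Indices are shifted by one: [X m] is the variable written X_{m+1} in the
   1-based notation, so that X_1, ..., X_j are [X 0], ..., [X j.-1]. *)

Section conditional_expectation.
Context d (Omega : measurableType d) (R : realType) (P : probability Omega R).

Definition is_condexp (G : set (set Omega)) (Y Z : Omega -> R) : Prop :=
  [/\ preimage_set_system setT Z measurable `<=` G,
      P.-integrable setT (EFin \o Z) &
      forall A, G A ->
        (\int[P]_(w in A) (Z w)%:E = \int[P]_(w in A) (Y w)%:E)%E].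

(* A chosen version of E[Y | G]; it is only meaningful for integrable Y and a
   sub-sigma-algebra G, in which case it is unique up to P-null sets. *)
Definition condexp (G : set (set Omega)) (Y : Omega -> R) : Omega -> R :=
  xget (cst 0) [set Z | is_condexp G Y Z].

End conditional_expectation.

Section iid.
Context d d' (Omega : measurableType d) (S : measurableType d') (R : realType)
  (P : probability Omega R).

Definition mutually_independent (X : nat -> {RV P >-> S}) : Prop :=
  forall (J : {fset nat}) (B : nat -> set S),
    (forall m, measurable (B m)) ->
    P (\bigcap_(m in [set` J]) X m @^-1` B m) =
    (\prod_(m <- J) P (X m @^-1` B m))%E.

(* Laws are compared on measurable sets only: the value of P elsewhere is
   irrelevant. *)
Definition identically_distributed (X : nat -> {RV P >-> S}) : Prop :=
  forall (m n : nat) (B : set S), measurable B ->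
    distribution P (X m) B = distribution P (X n) B.

Definition iid (X : nat -> {RV P >-> S}) : Prop :=
  mutually_independent X /\ identically_distributed X.

End iid.

Definition symmetric_kernel (r : nat) (S T : Type) (h : r.-tuple S -> T) : Prop :=
  forall (s : 'S_r) (t : r.-tuple S), h [tuple tnth t (s j) | j < r] = h t.

Section U_statistics.
Context d d' (Omega : measurableType d) (S : measurableType d') (R : realType)
  (P : probability Omega R) (r : nat).
Implicit Types (h : r.-tuple S -> R) (X : nat -> {RV P >-> S}).

Definition natural_filtration X (j : nat) : set (set Omega) :=
  g_sigma_preimage (fun m : 'I_j => X m : Omega -> S).

Definition kernel_value h X (w : Omega) : R := h [tuple X j w | j < r].

Definition Ustat h X (n : nat) (w : Omega) : R :=
  \sum_(t : r.-tuple 'I_n | sorted ltn [seq val j | j <- t])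
    h [tuple X (tnth t k) w | k < r].

Definition max_Ustat h X (N : nat) (w : Omega) : R :=
  \big[Num.max/0]_(r <= n < N.+1) `|Ustat h X n w|.

Definition degenerated_of_order h X (m : nat) : Prop :=
  [/\ P.-integrable setT (EFin \o kernel_value h X),
      {ae P, forall w,
         condexp P (natural_filtration X m) (kernel_value h X) w = 0} &
      ~ {ae P, forall w,
         condexp P (natural_filtration X m.+1) (kernel_value h X) w = 0}].

End U_statistics.

(* "C is an admissible value of the constant C_r": the defining property of
   C_r, with A and B playing the roles of A_r and B_r. *)
Definition maximal_inequality_constant (R : realType) (r : nat) (C : R) : Prop :=
  exists A B : R, [/\ 0 < A, 0 < B &
  forall (dS : measure_display) (S : measurableType dS) (h : r.-tuple S -> R)
    (dO : measure_display) (Omega : measurableType dO)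
    (P : probability Omega R) (X : nat -> {RV P >-> S}) (i : nat),
    measurable_fun setT h -> symmetric_kernel h -> iid X ->
    (2 <= i <= r)%N -> degenerated_of_order h X i.-1 ->
  forall (N : nat) (x y : R), (r <= N)%N -> 0 < x -> 0 < y ->
    3 ^+ r < x / y ->
  (P [set w | N%:R `^ (r%:R - i%:R / 2) * x < max_Ustat h X N w]%R <=
   (A * expR (- (1 / 2 * (x / y) `^ (2 / i%:R))))%:E +
   B%:E * \sum_(i <= k < r.+1)
     \int[lebesgue_measure]_(u in `[1%R, +oo[)
       (P [set w | y * N%:R `^ ((k%:R - i%:R) / 2) * u `^ (1 / 2) * C <
            `|condexp P (natural_filtration X k) (kernel_value h X) w| ]%R *
        ((1 + ln u) ^+ ((k * k.-1) %/ 2))%:E))%E].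

(* Main.v *)
(* Write [Y_k = E[Y | F_k]] and [M = E exp(|Y|^gamma)]. On [{Y_k > t}], which
   belongs to [F_k], one has [t P(Y_k > t) <= E[Y; Y_k > t]], and splitting [Y]
   at the level [t / 2] gives [P(|Y_k| > t) <= (4 K / t) exp(- (t / 2)^gamma / 2) M];
   this replaces Jensen's inequality, which is not available for [exp(|.|^gamma)]
   when [gamma < 1]. In the maximal inequality take [y] proportional to
   [x ^ (2 / (i gamma + 2))]: both the exponential term and every integral are
   then of the order [exp(- B x ^ (2 gamma / (i gamma + 2))) M]. *)

Require Import Defs.
From HB Require Import structures.
From mathcomp Require Import all_boot all_order all_algebra perm finmap.
From mathcomp Require Import all_classical all_reals all_analysis.
From mathcomp Require Import measurable_realfun ring lra.

Import Order.TTheory GRing.Theory Num.Theory.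
Import numFieldNormedType.Exports.

Local Open Scope classical_set_scope.
Local Open Scope ring_scope.

(** * Two comparison inequalities *)

(** The integral of a nonnegative function is a supremum over the simple functions below it, and
    those below [f] are also below [g]. This form applies to the integrands of the maximal
    inequality, which are probabilities depending on [u] whose measurability in [u] is never
    established. *)
Lemma ge0_le_integral_nonmeasurable d (T : measurableType d) (R : realType)
    (mu : {measure set T -> \bar R}) (D : set T) (f g : T -> \bar R) :
  (forall x, D x -> 0 <= f x)%E -> (forall x, D x -> f x <= g x)%E ->
  (\int[mu]_(x in D) f x <= \int[mu]_(x in D) g x)%E.
Proof.
move=> f0 fg.
have g0 x : D x -> (0 <= g x)%E by move=> Dx; exact: le_trans (f0 _ Dx) (fg _ Dx).
rewrite !ge0_integralE//; apply: ge_ereal_sup => _ [h hf <-] /=.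
apply: ereal_sup_ubound; exists h => // x.
apply: le_trans (hf x) _; rewrite /patch.
by case: ifPn => // /[!inE]; exact: fg.
Qed.

(** Raise [c * v ^ q <= exp (c * v ^ q)] to the power [p / q]; the choice [c = delta * q / p] makes
    the resulting exponent [delta * v ^ q]. *)
Lemma powR_le_expR (R : realType) (p q delta : R) :
  0 < p -> 0 < q -> 0 < delta ->
  exists2 K, 0 < K & forall v, 0 <= v -> v `^ p <= K * expR (delta * v `^ q).
Proof.
move=> p0 q0 d0; pose c := delta * (q / p).
have c0 : 0 < c by rewrite mulr_gt0// divr_gt0.
exists (c `^ (p / q))^-1; first by rewrite invr_gt0 powR_gt0.
move=> v v0; rewrite mulrC ler_pdivlMr ?powR_gt0//.
have -> : v `^ p = (v `^ q) `^ (p / q).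
  by rewrite -powRrM; congr (_ `^ _); field; rewrite gt_eqF.
rewrite mulrC -powRM ?powR_ge0//; last exact: ltW.
have -> : delta * v `^ q = c * v `^ q * (p / q).
  by rewrite /c; field; rewrite !gt_eqF.
rewrite expRM ge0_ler_powR ?nnegrE ?expR_ge0//.
- by rewrite divr_ge0 ?ltW.
- by rewrite mulr_ge0 ?powR_ge0 ?ltW.
- by rewrite ltW// (lt_le_trans _ (expR_ge1Dx _))// ltrDr.
Qed.

(** * Tails of conditional expectations *)

Section conditional_tail.
Context d (Omega : measurableType d) (R : realType) (P : probability Omega R).
Implicit Types (Y Z g : Omega -> R) (t m : R).

Lemma measurable_gtr Z t : measurable_fun setT Z -> measurable [set w | t < Z w].
Proof.
move=> mZ; have -> : [set w | t < Z w] = setT `&` Z @^-1` `]t, +oo[.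
  by apply/seteqP; split=> w /=; rewrite in_itv/= andbT => //; case.
by apply: mZ => //; exact: measurable_itv.
Qed.

(** The part of [Y] below [t / 2] contributes at most [(t / 2) P(Z > t)], which is absorbed by the
    lower bound [t P(Z > t)]; this leaves [2 / t] times the integral of the excess [g]. The
    averaging identity is assumed on the single event [Z > t], so that the lemma applies equally to
    [- Y] and [- Z]. *)
Lemma upper_tail_condexp Y Z g t m :
  P.-integrable setT (EFin \o Y) -> P.-integrable setT (EFin \o Z) ->
  (\int[P]_(w in [set w | (t < Z w)%R]) (Z w)%:E =
   \int[P]_(w in [set w | (t < Z w)%R]) (Y w)%:E)%E ->
  measurable_fun setT g -> (forall w, 0 <= g w) ->
  (\int[P]_w (g w)%:E <= m%:E)%E -> 0 < t ->
  (forall w, Y w <= t / 2 + g w) ->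
  (P [set w | (t < Z w)%R] <= (2 / t * m)%:E)%E.
Proof.
move=> iY iZ ZY mg g0 gm t0 Ytg.
set A := [set w | t < Z w] in ZY *.
have mA : measurable A.
  by apply: measurable_gtr; apply/measurable_EFinP; exact: measurable_int iZ.
have PA : P A \is a fin_num by rewrite fin_num_measure.
have ig : P.-integrable setT (EFin \o g).
  apply/integrableP; split; first exact/measurable_EFinP.
  under eq_integral do rewrite /= ger0_norm//.
  exact: le_lt_trans gm (ltry _).
have icst (a : R) : P.-integrable A (EFin \o cst a).
  exact: finite_measure_integrable_cst.
have iA (f : Omega -> R) : P.-integrable setT (EFin \o f) -> P.-integrable A (EFin \o f).
  exact: integrableS.
have lo : (t%:E * P A <= \int[P]_(w in A) (Z w)%:E)%E.
  rewrite -integral_cst//; apply: le_integral => //.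
  - exact: icst.
  - exact: iA.
  by move=> w; rewrite inE /A/= lee_fin => /ltW.
have hi : (\int[P]_(w in A) (Y w)%:E <= (t / 2)%:E * P A + m%:E)%E.
  apply: (le_trans (y := (\int[P]_(w in A) ((t / 2)%:E + (g w)%:E))%E)).
    apply: le_integral => //; first exact: iA.
      by apply: integrableD => //; [exact: icst|exact: iA].
    by move=> w _; rewrite -EFinD lee_fin.
  rewrite integralD//; [|exact: icst|exact: iA].
  rewrite integral_cst//; apply: leeD => //; apply: le_trans gm.
  apply: ge0_subset_integral => //; first exact/measurable_EFinP.
  by move=> w _; rewrite lee_fin.
rewrite ZY in lo; move: (le_trans lo hi).
rewrite -(fineK PA) -!EFinM -EFinD !lee_fin => tp.
by rewrite mulrAC ler_pdivlMr//; lra.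
Qed.

(** The one-sided bound is used for [Z] and for [- Z]: both events are preimages of Borel sets under
    [Z], hence lie in [G], and the two constants [2 / t] add up to [4 / t]. *)
Lemma tail_is_condexp (G : set (set Omega)) Y Z g t m :
  P.-integrable setT (EFin \o Y) -> is_condexp P G Y Z ->
  measurable_fun setT g -> (forall w, 0 <= g w) ->
  (\int[P]_w (g w)%:E <= m%:E)%E -> 0 < t ->
  (forall w, `|Y w| <= t / 2 + g w) ->
  (P [set w | (t < `|Z w|)%R] <= (4 / t * m)%:E)%E.
Proof.
move=> iY [GZ iZ ZY] mg g0 gm t0 Ytg.
have mZ : measurable_fun setT Z.
  by apply/measurable_EFinP; exact: measurable_int iZ.
have GI (B : set R) : measurable B -> G (Z @^-1` B).
  by move=> mB; apply: GZ; exists B => //; rewrite setTI.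
have Aup : [set w | t < Z w] = Z @^-1` `]t, +oo[.
  by apply/seteqP; split=> w /=; rewrite in_itv/= andbT.
have Adn : [set w | t < - Z w] = Z @^-1` `]-oo, - t[.
  by apply/seteqP; split=> w /=; rewrite in_itv/= ltrNr.
have iN (f : Omega -> R) : P.-integrable setT (EFin \o f) ->
    P.-integrable setT (EFin \o (fun w => - f w)).
  by move=> /integrableN; apply: eq_integrable.
have intN (f : Omega -> R) (B : set Omega) : measurable B ->
    P.-integrable setT (EFin \o f) ->
    (\int[P]_(w in B) (- f w)%:E = - \int[P]_(w in B) (f w)%:E)%E.
  move=> mB intf; rewrite -integralN//; apply: integrable_add_def => //.
  exact: integrableS intf.
have up : (P [set w | (t < Z w)%R] <= (2 / t * m)%:E)%E.
  apply: (@upper_tail_condexp Y Z g) => //.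
    by apply: ZY; rewrite Aup; apply: GI; exact: measurable_itv.
  by move=> w; exact: le_trans (ler_norm _) (Ytg w).
have dn : (P [set w | (t < - Z w)%R] <= (2 / t * m)%:E)%E.
  apply: (@upper_tail_condexp (fun w => - Y w) (fun w => - Z w) g) => //.
  - exact: iN.
  - exact: iN.
  - rewrite !intN//; try by apply: measurable_gtr; exact: measurable_funN.
    by congr (- _)%E; apply: ZY; rewrite Adn; apply: GI; exact: measurable_itv.
  - by move=> w; apply: le_trans (Ytg w); rewrite -normrN ler_norm.
have -> : [set w | t < `|Z w|] = [set w | t < Z w] `|` [set w | t < - Z w].
  by apply/seteqP; split=> w /=; rewrite ltr_normr; move/orP.
apply: le_trans (measureU2 _ _ _) _.
- exact: measurable_gtr.
- by apply: measurable_gtr; exact: measurable_funN.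
apply: le_trans (leeD up dn) _.
by rewrite -EFinD lee_fin -mulrDl -mulrDl; lra.
Qed.

Lemma tail_condexp (G : set (set Omega)) Y g t m :
  P.-integrable setT (EFin \o Y) ->
  measurable_fun setT g -> (forall w, 0 <= g w) ->
  (\int[P]_w (g w)%:E <= m%:E)%E -> 0 < t ->
  (forall w, `|Y w| <= t / 2 + g w) ->
  (P [set w | (t < `|condexp P G Y w|)%R] <= (4 / t * m)%:E)%E.
Proof.
move=> iY mg g0 gm t0 Ytg; rewrite /condexp.
case: xgetP => [Z _ GYZ|_]; first exact: (@tail_is_condexp G Y Z g).
(* If no version exists, [condexp] is the default [cst 0] and the event is empty because [t > 0];
   only [0 <= m] remains to be checked. *)
rewrite [X in P X](_ : _ = set0); last first.
  by apply/seteqP; split=> w //=; rewrite normr0 ltNge ltW.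
have m0 : 0 <= m; last by rewrite measure0 lee_fin mulr_ge0// divr_ge0// ltW.
rewrite -lee_fin.
by apply: le_trans gm; apply: integral_ge0 => w _; rewrite lee_fin.
Qed.

(** The excess of [|Y|] over [t / 2] is dominated by [g = K e exp(|Y|^gamma)]. Indeed, for
    [v > t / 2], half of the exponent pays for the linear factor, [v <= K exp(v^gamma / 2)], and the
    other half gives the decay, [exp(v^gamma / 2) <= e exp(v^gamma)]. *)
Lemma exp_tail_condexp (gamma K : R) (G : set (set Omega)) Y t m :
  0 < gamma -> 0 < K -> (forall v, 0 <= v -> v <= K * expR (1 / 2 * v `^ gamma)) ->
  P.-integrable setT (EFin \o Y) ->
  (\int[P]_w (expR (`|Y w| `^ gamma))%:E = m%:E)%E -> 0 < t ->
  (P [set w | (t < `|condexp P G Y w|)%R] <=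
   (4 * K / t * expR (- (1 / 2 * (t / 2) `^ gamma)) * m)%:E)%E.
Proof.
move=> gamma0 K0 Kexp iY Em t0.
set e := expR (- _).
have mY : measurable_fun setT Y by apply/measurable_EFinP; exact: measurable_int iY.
have mE : measurable_fun setT (fun w => expR (`|Y w| `^ gamma)).
  apply: measurableT_comp => //.
  apply: (measurableT_comp (measurable_powR _)).
  exact: measurableT_comp.
have -> : 4 * K / t * e * m = 4 / t * (K * e * m) by field; rewrite gt_eqF.
have Ke0 : 0 < K * e by rewrite mulr_gt0// expR_gt0.
apply: (@tail_condexp _ _ (fun w => K * e * expR (`|Y w| `^ gamma))) => //.
- exact: measurable_funM.
- by move=> w; rewrite mulr_ge0 ?expR_ge0 ?ltW.
- under eq_integral do rewrite EFinM.
  rewrite ge0_integralZl ?Em//.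
  + exact/measurable_EFinP.
  + by rewrite lee_fin ltW.
- move=> w; set v := `|Y w|; have v0 : 0 <= v by rewrite normr_ge0.
  have [vt|tv] := leP v (t / 2).
    by rewrite ler_wpDr// mulr_ge0 ?expR_ge0 ?ltW.
  apply: ler_wpDl; first by rewrite divr_ge0 ?ltW.
  apply: le_trans (Kexp v v0) _.
  rewrite -[leRHS]mulrA ler_pM2l// -expRD ler_expR.
  have : (t / 2) `^ gamma <= v `^ gamma.
    by apply: ge0_ler_powR; rewrite ?nnegrE// ?divr_ge0// ltW.
  lra.
Qed.

End conditional_tail.

(** * Integrability in [u], and balancing of the exponents *)

(** For [u >= 1] one has [0 <= 1 + ln u <= u], so the logarithmic factor is at most [u ^ n] for
    every [k <= n]. The exponential absorbs [u ^ (n + 2)], and the two spare powers leave a multiple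
    of [1 / (1 + u ^ 2)], with integral [pi / 2] over the half-line. *)
Lemma integral_stretched_exp_ln_le (R : realType) (delta q : R) (n : nat) :
  0 < delta -> 0 < q ->
  exists2 Q, 0 < Q & forall k, (k <= n)%N ->
    (\int[lebesgue_measure]_(u in `[1%R, +oo[)
       (expR (- (delta * u `^ q)) * (1 + ln u) ^+ k)%:E <= Q%:E)%E.
Proof.
move=> d0 q0.
have [K K0 HK] := @powR_le_expR R n.+2%:R q delta (ltr0Sn _ _) q0 d0.
exists (2 * K * (pi / 2)); first by rewrite !mulr_gt0 ?pi_gt0 ?divr_gt0.
move=> k kn.
have pos (u : R) : (0 <= (2 * K * (oneDsqr u)^-1)%:E)%E.
  by rewrite lee_fin mulr_ge0 ?invr_ge0 ?(le_trans ler01 (oneDsqr_ge1 u))// mulr_ge0// ltW.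
have mi : measurable_fun [set: R] (fun u : R => (oneDsqr u)^-1).
  by apply: continuous_measurable_fun; exact: continuous_oneDsqrV.
apply: (le_trans (y := (\int[lebesgue_measure]_(u in `[1%R, +oo[)
    (2 * K * (oneDsqr u)^-1)%:E)%E)).
  have ln_bd (u : R) : 1 <= u -> 0 <= 1 + ln u <= u.
    move=> u1; rewrite addr_ge0 ?ln_ge0//=.
    by have := @le_ln1Dx R (u - 1); rewrite addrCA subrr addr0; lra.
  apply: ge0_le_integral_nonmeasurable => u /=; rewrite in_itv/= andbT => u1.
    have /andP[l0 _] := ln_bd u u1.
    by rewrite lee_fin mulr_ge0 ?expR_ge0// exprn_ge0.
  have u0 : 0 < u by rewrite (lt_le_trans ltr01).
  have /andP[l0 lu] := ln_bd u u1.
  rewrite lee_fin expRN mulrC ler_pdivrMr ?expR_gt0//.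
  apply: le_trans (_ : u ^+ n <= _).
    by apply: le_trans (lerXn2r k _ _ lu) _; rewrite ?nnegrE ?(ltW u0)// ler_weXn2l.
  have := HK u (ltW u0); rewrite powR_mulrn ?(ltW u0)// => HKu.
  have s0 : 0 < oneDsqr u by rewrite (lt_le_trans ltr01 (oneDsqr_ge1 u)).
  rewrite mulrAC ler_pdivlMr//.
  have s2 : oneDsqr u <= 2 * u ^+ 2.
    by rewrite /oneDsqr; have := exprn_ege1 2 u1; lra.
  apply: le_trans (ler_wpM2l (exprn_ge0 n (ltW u0)) s2) _.
  rewrite mulrCA -exprD addn2 -mulrA ler_pM2l//.
apply: (le_trans (y := (\int[lebesgue_measure]_(u in `[0%R, +oo[)
    (2 * K * (oneDsqr u)^-1)%:E)%E)).
  apply: ge0_subset_integral => //.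
  - apply/measurable_EFinP; apply: measurable_funTS.
    exact: measurable_funM.
  - by move=> u /=; rewrite !in_itv/= !andbT; exact: le_trans.
under eq_integral do rewrite EFinM.
rewrite ge0_integralZl_EFin ?integral0y_oneDsqr//.
- by apply/measurable_EFinP; exact: measurable_funTS.
- by rewrite mulr_ge0// ltW.
Qed.

(* [z = x ^ (2 / (i gamma + 2))] balances the two exponents of the maximal
   inequality with [y] proportional to [z]: [(x / z) ^ (2 / i) = z ^ gamma]. *)
Lemma balanced_threshold (R : realType) (r i : nat) (gamma a b x : R) :
  (0 < i)%N -> 0 < gamma -> 0 < b -> b <= 1 -> b <= a ->
  3 `^ (r%:R * ((2 + i%:R * gamma) / (i%:R * gamma))) * a <= x ->
  exists z, [/\ b <= z, 3 ^+ r * b <= x / z,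
    (x / z) `^ (2 / i%:R) = z `^ gamma &
    z `^ gamma = x `^ (2 * gamma / (i%:R * gamma + 2))].
Proof.
move=> i0 gamma0 b0 b1 ba.
have {}i0 : 0 < i%:R :> R by rewrite ltr0n.
set j : R := i%:R in i0 *.
have jg0 : 0 < j * gamma by rewrite mulr_gt0.
have D0 : 0 < j * gamma + 2 by rewrite addr_gt0.
have a0 := lt_le_trans b0 ba.
set e := _ * (_ / _); set x0 := _ * a => x0x.
have e0 : 0 <= e by rewrite mulr_ge0// divr_ge0 ?(ltW jg0)// addr_ge0 ?(ltW jg0).
have pw1 : 1 <= 3 `^ e :> R.
  by have := @ler_powR R 3 (ler1n _ 3) 0 e e0; rewrite powRr0.
have ax : a <= x by apply: le_trans x0x; rewrite ler_peMl// ltW.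
have x_gt0 : 0 < x := lt_le_trans a0 ax.
pose th := 2 / (j * gamma + 2); pose th' := j * gamma / (j * gamma + 2).
have th_ge0 : 0 <= th by rewrite divr_ge0 ?(ltW D0).
have th'_ge0 : 0 <= th' by rewrite divr_ge0 ?(ltW D0) ?(ltW jg0).
have th_le1 : th <= 1 by rewrite ler_pdivrMr//; lra.
have th'_le1 : th' <= 1 by rewrite ler_pdivrMr//; lra.
(* [b <= b ^ s <= a ^ s]: the first inequality uses [b <= 1], the second [b <= a]. One [b] thus
   serves for both exponents [th] and [th'], whatever [i] is. *)
have b_pow s : 0 <= s -> s <= 1 -> b <= a `^ s.
  move=> s0 s1; apply: le_trans (ger1_powR _ s1) _; first by rewrite b0.
  by apply: ge0_ler_powR; rewrite ?nnegrE// ltW.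
have xz : x / x `^ th = x `^ th'.
  apply: (mulIf (x := x `^ th)); first by rewrite gt_eqF// powR_gt0.
  rewrite divfK ?gt_eqF ?powR_gt0// -powRD; last first.
    by rewrite (gt_eqF x_gt0) implybT.
  have -> : th' + th = 1 by rewrite /th /th' -mulrDl divff// gt_eqF.
  by rewrite powRr1// ltW.
exists (x `^ th); rewrite xz; split.
- apply: le_trans (b_pow th th_ge0 th_le1) _.
  by apply: ge0_ler_powR; rewrite ?nnegrE// ltW.
- apply: le_trans (_ : x0 `^ th' <= _); last first.
    have x0_ge0 : 0 <= x0 by rewrite mulr_ge0 ?powR_ge0// ltW.
    by apply: ge0_ler_powR; rewrite ?nnegrE// ltW.
  rewrite /x0 powRM ?powR_ge0 ?(ltW a0)// -powRrM.
  (* The power of 3 in the threshold on [x] is designed for this identity: it becomes exactly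
     [3 ^ r] in the lower bound for [x / z]. *)
  have -> : e * th' = r%:R.
    by rewrite /e /th'; field; rewrite !gt_eqF// addrC.
  by rewrite powR_mulrn// ler_pM2l ?exprn_gt0// b_pow.
- rewrite -!powRrM; congr (_ `^ _); rewrite /th /th'; field.
  by rewrite !gt_eqF.
- rewrite -powRrM; congr (_ `^ _); rewrite /th; field.
  by rewrite gt_eqF.
Qed.

(* The factor [expR] with [z `^ gamma] is split evenly: one half is the target
   rate, the other, with [z >= b], keeps the decay in [u] uniform. *)
Lemma tail_condexp_le d (Omega : measurableType d) (R : realType)
    (P : probability Omega R) (gamma K C b c z n u s m : R)
    (G : set (set Omega)) (Y : Omega -> R) :
  0 < gamma -> 0 < K -> (forall v, 0 <= v -> v <= K * expR (1 / 2 * v `^ gamma)) ->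
  0 < C -> 0 < b -> 0 < c -> b <= z -> 1 <= n -> 1 <= u -> 0 <= s ->
  P.-integrable setT (EFin \o Y) ->
  (\int[P]_w (expR (`|Y w| `^ gamma))%:E = m%:E)%E -> 0 <= m ->
  (P [set w | (c * z * n `^ s * u `^ (1 / 2) * C < `|condexp P G Y w|)%R] <=
   (4 * K / (c * b * C) * expR (- ((c * C / 2) `^ gamma / 4 * z `^ gamma)) * m *
    expR (- ((c * C / 2) `^ gamma * b `^ gamma / 4 * u `^ (gamma / 2))))%:E)%E.
Proof.
move=> gamma0 K0 HK C0 b0 c0 bz n1 u1 s0 iY Em m0; set beta := (c * C / 2) `^ gamma.
have z0 := lt_le_trans b0 bz.
have powR_ge1 (v p : R) : 1 <= v -> 0 <= p -> 1 <= v `^ p.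
  by move=> v1 p0; have := @ler_powR R v v1 0 p p0; rewrite powRr0.
have ns1 := powR_ge1 _ _ n1 s0.
have uh1 : 1 <= u `^ (1 / 2) by apply: powR_ge1.
set t := c * z * _ * _ * C.
have cz0 : 0 < c * z by rewrite mulr_gt0.
have uh0 : 0 < u `^ (1 / 2) by rewrite (lt_le_trans ltr01).
have st : c * z * u `^ (1 / 2) * C <= t.
  by rewrite /t ler_pM2r// ler_pM2r// ler_peMr// ltW.
have s_gt0 : 0 < c * z * u `^ (1 / 2) * C.
  by rewrite !mulr_gt0.
have t0 := lt_le_trans s_gt0 st.
have bt : c * b * C <= t.
  apply: le_trans st; rewrite ler_pM2r//.
  by apply: (le_trans (y := c * z)); [rewrite ler_pM2l|rewrite ler_peMr// ltW].
have cbC : 0 < c * b * C by rewrite !mulr_gt0.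
apply: le_trans (@exp_tail_condexp _ _ _ P gamma K G Y t m gamma0 K0 HK iY Em t0) _.
have beta0 : 0 < beta by rewrite powR_gt0// divr_gt0// mulr_gt0.
set U := u `^ (gamma / 2); set E := z `^ gamma.
have U1 : 1 <= U by rewrite powR_ge1// divr_ge0// ltW.
have bE : b `^ gamma <= E by apply: ge0_ler_powR; rewrite ?nnegrE// ltW.
have bg0 : 0 < b `^ gamma by rewrite powR_gt0.
have tpow : beta * E * U <= (t / 2) `^ gamma.
  have -> : beta * E * U = (c * z * u `^ (1 / 2) * C / 2) `^ gamma.
    have -> : c * z * u `^ (1 / 2) * C / 2 = c * C / 2 * z * u `^ (1 / 2) by lra.
    rewrite powRM ?powR_ge0//; last by rewrite mulr_ge0 ?divr_ge0 ?mulr_ge0 ?ltW.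
    rewrite powRM ?divr_ge0 ?mulr_ge0 ?ltW// -powRrM.
    by rewrite /U; congr (_ * _ `^ _); lra.
  have st2 : c * z * u `^ (1 / 2) * C / 2 <= t / 2 by rewrite ler_wpM2r.
  by apply: ge0_ler_powR; rewrite ?nnegrE ?divr_ge0// ltW.
rewrite lee_fin [leRHS]mulrAC; apply: ler_wpM2r => //.
rewrite -[leRHS]mulrA -expRD; apply: ler_pM; rewrite ?expR_ge0//.
- by rewrite !mulr_ge0 ?invr_ge0 ?ltW.
- by rewrite ler_pM2l ?mulr_gt0// lef_pV2 ?posrE.
rewrite ler_expR.
(* The product [E * U] dominates the average of [E] and [b ^ gamma * U], because [U >= 1] and
   [E >= b ^ gamma]. This separates [z] from [u]; together with the factor [1 / 2] in the tail bound
   it produces the [1 / 4] in both exponents. *)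
have EU : E + b `^ gamma * U <= 2 * (E * U).
  have : E * 1 <= E * U by rewrite ler_pM2l// (lt_le_trans bg0).
  have : b `^ gamma * U <= E * U by rewrite ler_pM2r// (lt_le_trans ltr01).
  lra.
have : beta * (E + b `^ gamma * U) <= beta * (2 * (E * U)) by rewrite ler_pM2l.
move: tpow; lra.
Qed.

(** * The exponential inequality for U-statistics *)

Theorem corollary1p9 (R : realType) (r : nat) (C : R) (gamma : R) :
  (1 <= r)%N -> 0 < C -> maximal_inequality_constant r C -> 0 < gamma ->
  exists A B : R, [/\ 0 < A, 0 < B &
  forall (dS : measure_display) (S : measurableType dS) (h : r.-tuple S -> R)
    (dO : measure_display) (Omega : measurableType dO)
    (P : probability Omega R) (X : nat -> {RV P >-> S}) (i : nat),
    measurable_fun setT h -> symmetric_kernel h -> iid X ->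
    (2 <= i <= r)%N -> degenerated_of_order h X i.-1 ->
  forall (x : R) (N : nat),
    3 `^ (r%:R * ((2 + i%:R * gamma) / (i%:R * gamma))) *
      2 `^ (- (1 / gamma)) * C^-1 <= x ->
    (r <= N)%N ->
  (P [set w | N%:R `^ (r%:R - i%:R / 2) * x < max_Ustat h X N w]%R <=
   (A * expR (- (B * x `^ (2 * gamma / (i%:R * gamma + 2)))))%:E *
   'E_P[fun w => expR (`|kernel_value h X w| `^ gamma)])%E].
Proof.
move=> _ C0 [A0 [B0 [A0_gt0 B0_gt0 maxineq]]] gamma0.
set a : R := 2 `^ (- (1 / gamma)) * C^-1.
have a0 : 0 < a by rewrite mulr_gt0 ?powR_gt0 ?invr_gt0.
(* With [y = c * z], the bound [x / z >= 3 ^ r * b] gives [x / y >= 2 * 3 ^ r], hence the strict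
   inequality required by the maximal inequality. These constants and those derived from them below
   do not depend on [i]. *)
pose b := Num.min 1 a; pose c := b / 2.
have b0 : 0 < b by rewrite lt_min ltr01.
have b1 : b <= 1 by rewrite ge_min lexx.
have ba : b <= a by rewrite ge_min lexx orbT.
have c0 : 0 < c by rewrite divr_gt0.
have [K K0 HK] : exists2 K : R, 0 < K &
    forall v, 0 <= v -> v <= K * expR (1 / 2 * v `^ gamma).
  have [|K K0 HK] := @powR_le_expR R 1 gamma (1 / 2) ltr01 gamma0; first by lra.
  by exists K => // v v0; rewrite -[leLHS]powRr1// HK.
pose beta := (c * C / 2) `^ gamma.
have beta0 : 0 < beta by rewrite powR_gt0// divr_gt0// mulr_gt0.
pose delta := beta * b `^ gamma / 4.
have delta0 : 0 < delta by rewrite divr_gt0// mulr_gt0// powR_gt0.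
have [//||Q Q0 HQ] := @integral_stretched_exp_ln_le R delta (gamma / 2) (r * r).
  by rewrite divr_gt0.
pose L := 4 * K / (c * b * C).
have L0 : 0 < L by rewrite divr_gt0 ?mulr_gt0.
have [L_ge0 Q_ge0] : 0 <= L /\ 0 <= Q by rewrite !ltW.
have rLQ0 : 0 <= B0 * (r%:R * (L * Q)).
  by apply: mulr_ge0; [exact: ltW|do 2 apply: mulr_ge0 => //].
(* [A0] comes from the exponential term, and [L * Q] bounds each of the at most [r] integrals up to
   the common decay and moment factors. The rates [1 / 2] and [beta / 4] are those of the
   exponential term and of the tails. *)
exists (A0 + B0 * (r%:R * (L * Q))), (Num.min (1 / 2) (beta / 4)); split.
- by rewrite ltr_pwDl.
- by rewrite lt_min divr_gt0//= divr_gt0.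
move=> dS S h dO Omega P X i mh sh iidX ir deg x N x0x rN.
have [iY _ _] := deg; have /andP[i2 ir'] := ir.
set Y := kernel_value h X in iY *.
set rate := Num.min _ _.
set M := 'E_P[_]%E.
(* [M >= 1] allows the exponential term, which carries no moment, to be multiplied by [M]. When [M]
   is infinite, the right-hand side is infinite as well. *)
have M1 : (1 <= M)%E.
  rewrite /M unlock -[leLHS](@probability_setT _ _ _ P) -[leLHS]mul1e.
  rewrite -integral_cst//; apply: ge0_le_integral_nonmeasurable => w _ /=.
    by rewrite lee_fin.
  by rewrite lee_fin -expR0 ler_expR powR_ge0.
have A_gt0 : 0 < A0 + B0 * (r%:R * (L * Q)) by rewrite ltr_pwDl.
case EM : M M1 => [m| |]//; last first.
  by move=> _; rewrite gt0_muley ?leey// lte_fin mulr_gt0 ?expR_gt0.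
rewrite lee_fin => m1.
have Em : (\int[P]_w (expR (`|Y w| `^ gamma))%:E = m%:E)%E by rewrite -EM /M unlock.
have m0 : 0 <= m := le_trans ler01 m1.
have i0 : (0 < i)%N by exact: leq_trans i2.
have [z [bz xz balz zE]] := @balanced_threshold R r i gamma a b x i0 gamma0 b0 b1 ba
  (eq_ind_r (fun v => v <= x) x0x (mulrA _ _ _)).
have z0 := lt_le_trans b0 bz.
have x0 : 0 < x.
  apply: lt_le_trans x0x; rewrite mulr_gt0 ?invr_gt0// mulr_gt0 ?powR_gt0//.
have cz0 : 0 < c * z by rewrite mulr_gt0.
have N1 : 1 <= N%:R :> R by rewrite ler1n; apply: leq_trans rN; exact: leq_trans ir'.
have xcz : x / (c * z) = x / z / c by field; rewrite !gt_eqF.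
have big_ratio : 3 ^+ r < x / (c * z).
  rewrite xcz ltr_pdivlMr//; apply: lt_le_trans xz.
  by rewrite ltr_pM2l ?exprn_gt0// /c; lra.
rewrite -zE; set E := z `^ gamma.
apply: le_trans (maxineq _ _ _ _ _ _ _ _ mh sh iidX ir deg _ x (c * z)
  rN x0 cz0 big_ratio) _.
(* As [c < 1], [x / y >= x / z], and [(x / z) ^ (2 / i)] is [z ^ gamma] by the balancing. *)
have first_le : A0 * expR (- (1 / 2 * (x / (c * z)) `^ (2 / i%:R))) <=
    A0 * expR (- (rate * E)) * m.
  rewrite -[leLHS]mulr1; apply: ler_pM => //.
    by rewrite mulr_ge0 ?expR_ge0 ?ltW.
  rewrite ler_pM2l// ler_expR lerN2.
  have rate_half : rate <= 1 / 2 by rewrite ge_min lexx.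
  apply: le_trans (ler_wpM2r (powR_ge0 _ _) rate_half) _.
  rewrite ler_pM2l// /E -balz.
  have xz0 : 0 < x / z by rewrite divr_gt0.
  have le_ratio : x / z <= x / (c * z).
    by rewrite xcz ler_pdivlMr// ler_piMr ?(ltW xz0)// /c; lra.
  by apply: ge0_ler_powR; rewrite ?nnegrE ?divr_ge0// ltW.
have term_le k : (i <= k < r.+1)%N ->
  (\int[lebesgue_measure]_(u in `[1%R, +oo[)
     (P [set w | c * z * N%:R `^ ((k%:R - i%:R) / 2) * u `^ (1 / 2) * C <
          `|condexp P (natural_filtration X k) Y w| ]%R *
      ((1 + ln u) ^+ ((k * k.-1) %/ 2))%:E) <=
   (L * expR (- (rate * E)) * m * Q)%:E)%E.
  case/andP => ik kr.
  have kn : ((k * k.-1) %/ 2 <= r * r)%N.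
    apply: leq_trans (leq_div _ _) _.
    by apply: leq_mul => //; exact: leq_trans (leq_pred _) _.
  pose W := L * expR (- (rate * E)) * m.
  have W0 : 0 <= W by do !apply: mulr_ge0 => //; exact: expR_ge0.
  apply: (le_trans (y := (\int[lebesgue_measure]_(u in `[1%R, +oo[) (W%:E *
    (expR (- (delta * u `^ (gamma / 2))) * (1 + ln u) ^+ ((k * k.-1) %/ 2))%:E))%E)).
    apply: ge0_le_integral_nonmeasurable => u /=; rewrite in_itv/= andbT => u1.
      by rewrite mule_ge0// lee_fin exprn_ge0// addr_ge0// ln_ge0.
    rewrite [X in (_ <= _ * X)%E]EFinM muleA; apply: lee_wpmul2r.
      by rewrite lee_fin exprn_ge0// addr_ge0// ln_ge0.
    (* [k >= i] and [N >= 1] make the power of [N] at least 1, so all [k] share the same bound. *)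
    have ki0 : 0 <= (k%:R - i%:R) / 2 :> R by rewrite divr_ge0// subr_ge0 ler_nat.
    apply: le_trans (@tail_condexp_le _ _ _ P gamma K C b c z N%:R u _ m
      (natural_filtration X k) Y gamma0 K0 HK C0 b0 c0 bz N1 u1 ki0 iY Em m0) _.
    rewrite -EFinM lee_fin ler_wpM2r ?expR_ge0//.
    rewrite /W ler_wpM2r// ler_pM2l// ler_expR lerN2.
    by rewrite ler_wpM2r ?powR_ge0// ge_min lexx orbT.
  rewrite ge0_integralZl_EFin//.
  - by rewrite -/W [leRHS](EFinM W Q); apply: lee_wpmul2l => //; exact: HQ.
  - move=> u /=; rewrite in_itv/= andbT => u1.
    by rewrite lee_fin mulr_ge0 ?expR_ge0// exprn_ge0// addr_ge0// ln_ge0.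
  - apply/measurable_EFinP; apply: measurable_funM.
      apply: measurableT_comp => //; apply: measurableT_comp => //.
      apply: measurable_funM => //; apply: measurable_funTS.
      exact: measurable_powR.
    apply: measurable_funX; apply: measurable_funD => //.
    by apply: measurable_funTS; exact: measurable_ln.
have sum_le : (\sum_(i <= k < r.+1)
  \int[lebesgue_measure]_(u in `[1%R, +oo[)
     (P [set w | c * z * N%:R `^ ((k%:R - i%:R) / 2) * u `^ (1 / 2) * C <
          `|condexp P (natural_filtration X k) Y w| ]%R *
      ((1 + ln u) ^+ ((k * k.-1) %/ 2))%:E) <=
   (r%:R * (L * expR (- (rate * E)) * m * Q))%:E)%E.
  have W0 : 0 <= L * expR (- (rate * E)) * m * Q.
    by do !apply: mulr_ge0 => //; exact: expR_ge0.
  (* The sum has [r + 1 - i] terms, at most [r] since [i >= 1]. *)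
  rewrite big_nat; apply: le_trans (lee_sum _ term_le) _.
  rewrite sumEFin -big_nat sumr_const_nat lee_fin -[leLHS]mulr_natl.
  by rewrite ler_wpM2r// ler_nat leq_subLR -add1n leq_add2r.
apply: (le_trans (y := ((A0 * expR (- (rate * E)) * m)%:E +
    B0%:E * (r%:R * (L * expR (- (rate * E)) * m * Q))%:E)%E)).
  apply: leeD; first by rewrite lee_fin.
  by apply: lee_wpmul2l => //; rewrite lee_fin ltW.
rewrite -!EFinM -EFinD lee_fin [leRHS](_ : _ =
    A0 * expR (- (rate * E)) * m + B0 * (r%:R * (L * expR (- (rate * E)) * m * Q)))//.
by clearbody L rate E; ring.
Qed.
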